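(* For every sufficiently large positive integer $n$, setting $L=n$, there exist a distribution $\mu$ over $\{0,1\}^n$, a function $g^*:\{0,1\}^n\to\Delta_L$, a circuit $f:\{0,1\}^n\to[-1,1]^L$ of size $O(n)$, and a convex function $\varphi:\Delta_L\to\mathbb R$ together with a choice of subgradient $\nabla\varphi(v)\in[-1,1]^L$ at every $v\in\Delta_L$, such that the following holds: every function $s:\{0,1\}^n\to\Delta_L$ satisfying $$\big|\mathbb E_{x\sim\mu}\langle s(x)-g^*(x),f(x)\rangle\big|\le 0.05\quad\text{and}\quad \mathsf H_\varphi(s)\ge\mathsf H_\varphi(g^* )-0.05$$ must have circuit complexity $\exp(\Omega(n))=\exp(\Omega(L))$. Moreover, $f$ can be chosen to be the identity function $f(x)=x\in\{0,1\}^n\subseteq[-1,1]^L$.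
   Context: $\Delta_L$ denotes the set of probability distributions (probability mass vectors) on $[L]=\{1,\dots,L\}$, viewed as a subset of $\mathbb R^L$; $\langle\cdot,\cdot\rangle$ is the standard inner product on $\mathbb R^L$. For convex $\varphi:\Delta_L\to\mathbb R$ and $g:\{0,1\}^n\to\Delta_L$, $\mathsf H_\varphi(g):=-\mathbb E_{x\sim\mu}[\varphi(g(x))]$. *)

(* Defs.v *)
From HB Require Import structures.
From mathcomp Require Import all_boot all_order all_algebra.
From mathcomp Require Import all_classical all_reals all_analysis.

Set Implicit Arguments.
Unset Strict Implicit.
Unset Printing Implicit Defensive.

Import Order.TTheory GRing.Theory Num.Theory.

Local Open Scope classical_set_scope.
Local Open Scope ring_scope.

Definition is_pmf (R : realType) (T : finType) (p : T -> R) : Prop :=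
  (forall t, 0 <= p t) /\ \sum_t p t = 1.

Definition expect (R : realType) (T : finType) (mu F : T -> R) : R :=
  \sum_t mu t * F t.

Definition simplex (R : realType) (L : nat) : set 'rV[R]_L :=
  [set v | is_pmf (fun i => v 0 i)].

Definition cube (R : realType) (L : nat) : set 'rV[R]_L :=
  [set v | forall i, -1 <= v 0 i <= 1].

Arguments simplex R L : clear implicits.
Arguments cube R L : clear implicits.

Definition inner (R : realType) (L : nat) (u v : 'rV[R]_L) : R :=
  \sum_i u 0 i * v 0 i.

Definition entropy (R : realType) (n L : nat) (mu : n.-tuple bool -> R)
    (phi : 'rV[R]_L -> R) (g : n.-tuple bool -> 'rV[R]_L) : R :=
  - expect mu (fun x => phi (g x)).

(* d is a subgradient of phi, as a function on the simplex, at v. *)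
Definition subgradient (R : realType) (L : nat) (phi : 'rV[R]_L -> R)
    (v d : 'rV[R]_L) : Prop :=
  forall u, simplex R L u -> phi v + inner d (u - v) <= phi u.

(* Boolean circuits as straight-line programs: wires 0, ..., n-1 carry the
   inputs and wire n + k carries the value of the k-th gate. A gate reads wires
   computed before it; any other wire number reads the constant false. *)
Inductive gate : Type :=
  | Gconst of bool
  | Gnot of nat
  | Gand of nat & nat
  | Gor of nat & nat.

Definition gate_val (w : seq bool) (g : gate) : bool :=
  match g with
  | Gconst b => b
  | Gnot i => ~~ nth false w i
  | Gand i j => nth false w i && nth false w j
  | Gor i j => nth false w i || nth false w j
  end.

Definition run (gs : seq gate) (w : seq bool) : seq bool :=
  foldl (fun w g => rcons w (gate_val w g)) w gs.

(* A circuit with real outputs returns rationals in binary: a sign bit, a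
   numerator and a denominator (least significant bit first), of any width. *)
Record rat_out : Type := RatOut {
  out_sign : nat;
  out_num : seq nat;
  out_den : seq nat
}.

Definition nat_of_bits (s : seq bool) : nat :=
  foldr (fun (b : bool) (m : nat) => b + m.*2)%N 0%N s.

Definition rat_out_val (R : realType) (w : seq bool) (o : rat_out) : R :=
  let bits ws := nat_of_bits [seq nth false w i | i <- ws] in
  (-1) ^+ (nth false w (out_sign o)) *
    ((bits (out_num o))%:R / (bits (out_den o))%:R).

Definition rat_out_size (o : rat_out) : nat :=
  (size (out_num o) + size (out_den o)).+1.

Record circuit (L : nat) : Type := Circuit {
  gates : seq gate;
  outs : L.-tuple rat_out
}.

(* Output nodes are counted: otherwise a circuit with very few gates could
   return arbitrarily many output bits for free. *)
Definition circuit_size (L : nat) (C : circuit L) : nat :=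
  (size (gates C) + \sum_(i < L) rat_out_size (tnth (outs C) i))%N.

Definition circuit_eval (R : realType) (n L : nat) (C : circuit L)
    (x : n.-tuple bool) : 'rV[R]_L :=
  \row_i rat_out_val R (run (gates C) x) (tnth (outs C) i).

Definition computes (R : realType) (n L : nat) (C : circuit L)
    (F : n.-tuple bool -> 'rV[R]_L) : Prop :=
  forall x, circuit_eval R C x = F x.

(* +oo if no circuit computes F, i.e. if F has an irrational entry. *)
Definition circuit_complexity (R : realType) (n L : nat)
    (F : n.-tuple bool -> 'rV[R]_L) : \bar R :=
  ereal_inf [set ((circuit_size C)%:R)%:E | C in [set C | computes C F]].

(* Main.v *)
(** Take a code of [2 ^ Omega(n)] words, pairwise agreeing in at most half of
    their positions, and let [x] range uniformly over a set [T] of bit strings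
    in which every letter of a codeword is marked by a pair of coordinates, one
    on each of two sides. A random bit [a x] selects one side, and [gstar x] is
    uniform on the part of the support of [x] lying on that side, so that
    [<gstar x, x> = 1]. Let [phi] be the maximum of [0] and of the linear forms
    [penalty x], [x] in [T], which charge [1] on the wrong side of the support
    of [x], [0] on the right side and [-1] off the support. The distance of the
    code gives [phi (gstar x) = 0]. If [s] is as in the theorem, then on average
    [s x] has mass at least [0.95] on the support of [x] and
    [phi (s x) <= 0.05], so comparing its masses on the two sides recovers
    [a x] for at least three quarters of [T]. Counting shows that for some [a]
    no circuit of size [2 ^ (n / 128)] achieves this. *)
Require Import Defs.
From HB Require Import structures.
From mathcomp Require Import all_boot all_order all_algebra.
From mathcomp Require Import all_classical all_reals all_analysis.
From mathcomp Require Import zify lra.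

Set Implicit Arguments.
Unset Strict Implicit.
Unset Printing Implicit Defensive.

Import Order.TTheory GRing.Theory Num.Theory.

Local Open Scope classical_set_scope.
Local Open Scope ring_scope.

(** * Agreement counts: a code of large distance and a function hard to predict *)

Section Agreement.
Local Open Scope nat_scope.

(* Used as a generating function: Markov's inequality applied to the weight
   [t ^ agreement] bounds the size of Hamming balls. *)
Lemma sum_exp_agree (I J : finType) (A : {set I}) (u : I -> J) (t : nat) :
  \sum_(w : {ffun I -> J}) t ^ #|[set i in A | w i == u i]|%SET =
  (t + #|J|.-1) ^ #|A| * #|J| ^ #|~: A|%SET.
Proof.
pose F i j := if (i \in A) && (j == u i) then t else 1.
transitivity (\sum_(w : {ffun I -> J}) \prod_i F i (w i)).
  apply: eq_bigr => w _; rewrite /F -big_mkcond /= prod_nat_const.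
  by congr (_ ^ _); apply: eq_card => i; rewrite !inE.
rewrite -bigA_distr_bigA (bigID (mem A)) /=; congr (_ * _).
  rewrite -prod_nat_const; apply: eq_bigr => i iA.
  rewrite (bigD1 (u i)) //= /F iA eqxx /=; congr (_ + _).
  rewrite (eq_bigr (fun=> 1)) => [|j /negPf ->] //.
  by rewrite sum1_card cardC1.
rewrite -prod_nat_const; apply: eq_big => [i|i /negPf iA]; first by rewrite !inE.
by rewrite /F iA /= sum1_card.
Qed.

Lemma code_exists (m : nat) : 0 < m ->
  exists T : {set {ffun 'I_m -> 'I_16}},
    {in T &, forall u v : {ffun 'I_m -> 'I_16}, u != v -> 2 * #|[set i | u i == v i]%SET| <= m} /\
    2 ^ m <= #|T|.
Proof.
move=> m0.
pose agree (u v : {ffun 'I_m -> 'I_16}) := #|[set i | u i == v i]%SET|.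
(* Gilbert-Varshamov: the balls around a maximal code cover the space. *)
pose P (T : {set {ffun 'I_m -> 'I_16}}) :=
  [forall u in T, forall v in T, (u != v) ==> (2 * agree u v <= m)].
have P0 : P finset.set0 by apply/forall_inP => u; rewrite inE.
have [T /maxsetP[PT Tmax] _] := maxset_exists P0.
exists T; split.
  by move=> u v uT vT uv; move/forall_inP: PT => /(_ _ uT) /forall_inP /(_ _ vT)
     /implyP /(_ uv).
pose ball u := [set w | m < 2 * agree w u]%SET.
have agreeC u v : agree u v = agree v u.
  by apply: eq_card => i; rewrite !inE eq_sym.
have cover w : exists2 u, u \in T & w \in ball u.
  have [wT|wT] := boolP (w \in T).
    exists w => //; rewrite inE /agree.
    have -> : [set i | w i == w i]%SET = [set: 'I_m]%SET by apply/setP => i; rewrite !inE eqxx.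
    by rewrite cardsT card_ord; lia.
  case: (boolP [exists u in T, w \in ball u]) => [/exists_inP[u uT uw]|].
    by exists u.
  rewrite negb_exists_in => /forall_inP far.
  have far' u : u \in T -> 2 * agree w u <= m.
    by move=> /far; rewrite inE -leqNgt.
  case/negP: wT; rewrite -(Tmax (w |: T)%SET) ?finset.setU11 ?finset.subsetUr //.
  apply/forall_inP => u /setU1P[->|uT]; apply/forall_inP => v /setU1P[->|vT];
    apply/implyP => uv.
  - by rewrite eqxx in uv.
  - exact: far'.
  - by rewrite agreeC; exact: far'.
  - by move/forall_inP: PT => /(_ _ uT) /forall_inP /(_ _ vT) /implyP /(_ uv).
(* A word of the ball agrees with [u] in more than half of the positions, so its weight for [t = 16]
   is at least [16 ^ (m / 2) = 4 ^ m]; all weights together sum to [(16 + 15) ^ m]. *)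
have vol u : #|ball u| * 4 ^ m <= 31 ^ m.
  have := sum_exp_agree [set: 'I_m]%SET u 16; rewrite finset.setCT cards0 cardsT !card_ord muln1 => /esym E.
  rewrite {}[X in _ <= X]E -sum_nat_const big_mkcond /=; apply: leq_sum => w _.
  case: ifP => //; rewrite inE => /ltnW H.
  have -> : 4 ^ m = 2 ^ (2 * m) by rewrite expnM.
  have -> : #|[set i in [set: 'I_m] | w i == u i]|%SET = agree w u.
    by apply: eq_card => i; rewrite !inE.
  rewrite -(expnM 2 4) leq_exp2l //; lia.
have total : 16 ^ m <= \sum_(u in T) #|ball u|.
  have -> : 16 ^ m = \sum_(w : {ffun 'I_m -> 'I_16}) 1.
    by rewrite sum1_card card_ffun !card_ord.
  under [X in _ <= X]eq_bigr do rewrite -sum1_card big_mkcond.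
  rewrite exchange_big; apply: leq_sum => w _.
  by have [u uT uw] := cover w; rewrite (bigD1 u) //= uw.
have : 16 ^ m * 4 ^ m <= #|T| * 31 ^ m.
  rewrite (leq_trans (leq_mul total (leqnn (4 ^ m)))) // big_distrl -sum_nat_const.
  by apply: leq_sum => u _; exact: vol.
(* The claim follows from [2 * 31 <= 16 * 4]. *)
rewrite -expnMn => H; rewrite -(@leq_pmul2r (31 ^ m)) ?expn_gt0 // -expnMn.
by apply: leq_trans H; rewrite leq_exp2r.
Qed.

(** Union bound over the predictors [b z]: each errs on at most a quarter of [T] for only a fraction
    [(25 / 32) ^ (#|T| / 2)] of all [a]. The bounds are squared to keep exponents integral. *)
Lemma hard_on_average (X Z : finType) (T : {set X}) (b : Z -> X -> bool) :
  #|Z| ^ 2 * 25 ^ #|T| < 32 ^ #|T| ->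
  exists a : {ffun X -> bool},
    forall z, #|T| < 4 * #|[set x in T | a x != b z x]%SET|.
Proof.
move=> small.
pose good z (a : {ffun X -> bool}) := #|T| < 4 * #|[set x in T | a x != b z x]%SET|.
pose bad z := [set a | ~~ good z a]%SET.
case: (boolP [exists a : {ffun X -> bool}, [forall z, good z a]]).
  by move=> /existsP[a /forallP ?]; exists a.
rewrite negb_exists => /forallP nogood.
have vol z : #|bad z| ^ 2 * 32 ^ #|T| <= 25 ^ #|T| * 4 ^ #|X|.
  have E := sum_exp_agree T (b z) 4; rewrite card_bool /= in E.
  pose N := #|T|.
  (* A bad [a] agrees with [b z] on at least [3 * N / 4] points, so its weight for [t = 4] is at
     least [4 ^ (3 * N / 4)], whose square is [8 ^ N]. *)
  have lb a : a \in bad z -> 8 ^ N <= (4 ^ #|[set x in T | a x == b z x]%SET|) ^ 2.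
    rewrite inE /good -leqNgt => H.
    have : #|[set x in T | a x == b z x]%SET| + #|[set x in T | a x != b z x]%SET| = N.
      rewrite /N -(cardsID [set x | a x == b z x]%SET T).
      by congr (_ + _); apply: eq_card => x; rewrite !inE // andbC.
    move=> H2.
    have -> : 8 ^ N = 2 ^ (3 * N) by rewrite expnM.
    have -> : 4 = 2 ^ 2 by [].
    rewrite -!expnM leq_exp2l //.
    have arith g e k : 4 * e <= k -> g + e = k -> 3 * k <= 2 * (g * 2) by lia.
    exact: arith H H2.
  have lb2 a a' : a \in bad z -> a' \in bad z ->
      8 ^ N <= 4 ^ #|[set x in T | a x == b z x]%SET| * 4 ^ #|[set x in T | a' x == b z x]%SET|.
    by move=> /lb La /lb La'; rewrite -(@leq_exp2r _ _ 2) // expnMn leq_mul // La.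
  have : #|bad z| ^ 2 * 8 ^ N <= (5 ^ N * 2 ^ #|~: T|%SET) ^ 2.
    rewrite -E (@leq_trans ((\sum_(a in bad z) 4 ^ #|[set x in T | a x == b z x]%SET|) ^ 2)) //.
      rewrite -!mulnn big_distrlr /= -mulnA -!sum_nat_const.
      apply: leq_sum => a aB; apply: leq_sum => a' a'B.
      exact: lb2.
    by rewrite leq_exp2r // [X in _ <= X](bigID (mem (bad z))) /= leq_addr.
  rewrite -(@leq_pmul2r (4 ^ N)) ?expn_gt0 // -mulnA -expnMn => H.
  apply: (leq_trans H); rewrite expnMn -!expnM (mulnC N) (mulnC #|~: _|%SET) !(expnM _ 2).
  by rewrite -mulnA -expnD addnC cardsC.
have smaller z : #|bad z| * #|Z| < 2 ^ #|X|.
  have E4 : (2 ^ #|X|) ^ 2 = 4 ^ #|X| by rewrite -expnM mulnC expnM.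
  rewrite -(@ltn_exp2r _ _ 2) // expnMn E4 mulnC -(@ltn_pmul2r (32 ^ #|T|)) ?expn_gt0 //.
  rewrite (leq_ltn_trans (n := #|Z| ^ 2 * (25 ^ #|T| * 4 ^ #|X|))) //.
    by rewrite -mulnA leq_mul2l vol orbT.
  by rewrite mulnA (mulnC _ (32 ^ _)) ltn_pmul2r ?expn_gt0.
have cover : 2 ^ #|X| <= \sum_z #|bad z|.
  have -> : 2 ^ #|X| = \sum_(a : {ffun X -> bool}) 1.
    by rewrite sum1_card card_ffun card_bool.
  under [X in _ <= X]eq_bigr do rewrite -sum1_card big_mkcond.
  rewrite exchange_big; apply: leq_sum => a _.
  move: (nogood a); rewrite negb_forall => /existsP[z az].
  by rewrite (bigD1 z) //= inE az.
(* Summing the strict bounds gives [#|Z| * (1 + \sum_z #|bad z|) <= #|Z| * 2 ^ #|X|], against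
   [cover]. If [Z] is empty, [cover] itself is absurd. *)
have : \sum_z (#|bad z| * #|Z|).+1 <= \sum_(z : Z) 2 ^ #|X|.
  by apply: leq_sum => z _; exact: smaller.
rewrite sum_nat_const; under eq_bigr do rewrite -addn1.
rewrite big_split /= sum1_card -big_distrl /=.
have : 0 < 2 ^ #|X| by rewrite expn_gt0.
have [Z0|] := posnP #|Z|; last first.
  by move=> Z0 _; rewrite (mulnC (\sum_z _)) -mulnSr leq_pmul2l // ltnNge cover.
by move: cover; rewrite big_pred0 ?leqn0 => [/eqP->//|z]; exact: (card0_eq Z0 z).
Qed.

End Agreement.

(** * Finite codes for circuits of bounded size *)

Section CircuitCodes.
Variables (n S L : nat).
Local Open Scope nat_scope.

Local Notation wire := 'I_(n + S).+1.

Definition gcode : Type := (bool + wire + wire * wire + wire * wire)%type.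

Definition gdecode (z : gcode) : gate :=
  match z with
  | inl (inl (inl b)) => Gconst b
  | inl (inl (inr i)) => Gnot i
  | inl (inr (i, j)) => Gand i j
  | inr (i, j) => Gor i j
  end.

(* Codes of circuits of size at most [S]: gate lists are padded with [Gconst
   false] to length [S] and all wire numbers are clipped to [n + S], which always
   reads [false]; bit lists are padded with that wire, which is harmless as the
   least significant bit comes first. *)
Definition ccode : Type :=
  (S.-tuple gcode * L.-tuple (wire * S.-tuple wire * S.-tuple wire))%type.

Definition odecode (z : wire * S.-tuple wire * S.-tuple wire) : rat_out :=
  RatOut (z.1.1 : wire) (map val z.1.2) (map val z.2).

Definition cdecode (z : ccode) : circuit L :=
  Circuit (map gdecode z.1) (map_tuple odecode z.2).

Lemma card_ccode :
  #|{: ccode}| = (2 + (n + S).+1 + (n + S).+1 * (n + S).+1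
                    + (n + S).+1 * (n + S).+1) ^ S
    * ((n + S).+1 * (n + S).+1 ^ S * (n + S).+1 ^ S) ^ L.
Proof.
by rewrite card_prod !card_tuple !card_sum !card_prod !card_tuple card_bool !card_ord.
Qed.

Definition clip (i : nat) : wire := inord (minn i (n + S)).

Lemma nth_clip (w : seq bool) (i : nat) : size w <= n + S ->
  nth false w (clip i) = nth false w i.
Proof.
move=> sw; rewrite inordK ?ltnS ?geq_minr //.
by have [//|le_i] := leqP i (n + S); rewrite !nth_default //; lia.
Qed.

Definition gencode (g : gate) : gcode :=
  match g with
  | Gconst b => inl (inl (inl b))
  | Gnot i => inl (inl (inr (clip i)))
  | Gand i j => inl (inr (clip i, clip j))
  | Gor i j => inr (clip i, clip j)
  end.

Lemma gate_val_clip (w : seq bool) (g : gate) : size w <= n + S ->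
  gate_val w (gdecode (gencode g)) = gate_val w g.
Proof. by move=> sw; case: g => [b|i|i j|i j] //=; rewrite !nth_clip. Qed.

Lemma run_clip (gs : seq gate) (w : seq bool) : size w + size gs <= n + S ->
  run (map (gdecode \o gencode) gs) w = run gs w.
Proof.
elim: gs w => //= g gs IH w sw.
rewrite gate_val_clip ?IH ?size_rcons //; lia.
Qed.

Lemma run_pad (w : seq bool) (j : nat) :
  run (nseq j (Gconst false)) w = w ++ nseq j false.
Proof. by elim: j w => [|j IH] w /=; rewrite ?cats0 // IH cat_rcons. Qed.

Lemma size_run (gs : seq gate) (w : seq bool) :
  size (run gs w) = size w + size gs.
Proof. by elim: gs w => [|g gs IH] w /=; rewrite ?addn0 // IH size_rcons addSnnS. Qed.

Lemma nth_pad (w : seq bool) (i j : nat) :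
  nth false (w ++ nseq j false) i = nth false w i.
Proof.
rewrite nth_cat nth_nseq; case: ltnP => // le_i.
by rewrite if_same nth_default.
Qed.

Lemma nat_of_bits_pad (s : seq bool) (j : nat) :
  nat_of_bits (s ++ nseq j false) = nat_of_bits s.
Proof.
elim: s => [|b s IH] /=; last by rewrite -IH.
by elim: j => //= j ->.
Qed.

(** The [take] forces length [S] for every input; lists of at most [S] wires lose nothing. *)
Definition pad_wires (s : seq nat) : seq wire :=
  take S (map clip s ++ nseq S ord_max).

Lemma size_pad_wires (s : seq nat) : size (pad_wires s) == S.
Proof.
by rewrite size_take size_cat size_nseq; case: ltnP => //; lia.
Qed.

Lemma bits_pad_wires (w : seq bool) (s : seq nat) :
  size w <= n + S -> size s <= S ->
  nat_of_bits [seq nth false w i | i <- map val (pad_wires s)] =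
  nat_of_bits [seq nth false w i | i <- s].
Proof.
move=> sw ss; rewrite /pad_wires take_cat size_map ltnNge ss /= take_nseq ?leq_subr //.
rewrite !map_cat !map_nseq [nth _ _ _]nth_default //= nat_of_bits_pad.
congr nat_of_bits; rewrite -!map_comp; apply: eq_map => i /=; exact: nth_clip.
Qed.

Definition oencode (o : rat_out) : wire * S.-tuple wire * S.-tuple wire :=
  (clip (out_sign o), Tuple (size_pad_wires (out_num o)),
   Tuple (size_pad_wires (out_den o))).

Lemma size_gates_pad (gs : seq gate) : size gs <= S ->
  size (map gencode gs ++ nseq (S - size gs) (gencode (Gconst false))) == S.
Proof. by move=> ss; rewrite size_cat size_map size_nseq subnKC. Qed.

Lemma ccode_exists (R : realType) (C : circuit L) : circuit_size C <= S ->
  exists z : ccode, forall x : n.-tuple bool,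
    circuit_eval R (cdecode z) x = circuit_eval R C x.
Proof.
move=> sC; have sg : size (gates C) <= S.
  by apply: leq_trans sC; rewrite /circuit_size leq_addr.
exists (Tuple (size_gates_pad sg), map_tuple oencode (outs C)) => x.
apply/rowP => i; rewrite !mxE /= !tnth_map.
have so : rat_out_size (tnth (outs C) i) <= S.
  by apply: leq_trans sC; rewrite /circuit_size (bigD1 i) //= addnCA leq_addr.
set w := run _ _; set w' := run _ _.
(* The padding gates only append wires that read [false], as absent wires do. *)
have -> : w = w' ++ nseq (S - size (gates C)) false.
  rewrite /w map_cat /run foldl_cat -/(run _ _) -/(run _ _) -map_comp.
  by rewrite run_clip ?size_tuple ?leq_add2l // map_nseq run_pad.
set v := _ ++ _.
have sv : size v <= n + S.
  by rewrite size_cat size_nseq size_run size_tuple -addnA subnKC.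
have Ev j : nth false v j = nth false w' j by exact: nth_pad.
move: so; rewrite /rat_out_size /rat_out_val /= => so.
rewrite !bits_pad_wires ?nth_clip //; try lia.
by rewrite !Ev !(eq_map Ev).
Qed.

End CircuitCodes.

(** * Maxima of linear forms: convexity and subgradients *)

Section MaxLinear.
Variables (R : realType) (L : nat).
Implicit Types u v d : 'rV[R]_L.

Lemma innerC u v : inner u v = inner v u.
Proof. by apply: eq_bigr => i _; rewrite mulrC. Qed.

Lemma innerDr u v d : inner d (u + v) = inner d u + inner d v.
Proof. by rewrite -big_split; apply: eq_bigr => i _; rewrite !mxE mulrDr. Qed.

Lemma innerZr (t : R) v d : inner d (t *: v) = t * inner d v.
Proof. by rewrite [RHS]big_distrr; apply: eq_bigr => i _; rewrite !mxE mulrCA. Qed.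

Lemma innerBr u v d : inner d (u - v) = inner d u - inner d v.
Proof. by rewrite innerDr -scaleN1r innerZr mulN1r. Qed.

Variables (I : finType) (T : {set I}) (h : I -> 'rV[R]_L).

Definition max_linear v : R := \big[Num.max/0]_(y in T) inner (h y) v.

Hypothesis h_cube : forall y, cube R L (h y).

(** A form attaining the maximum at [v], or the zero form, lies below [max_linear] everywhere.
    Subgradients and convexity both come from it. *)
Lemma max_linear_support v : exists d,
  [/\ cube R L d, inner d v = max_linear v & forall u, inner d u <= max_linear u].
Proof.
have inner0 u : inner 0 u = 0 by rewrite /inner big1 // => i _; rewrite mxE mul0r.
have [v0|[y yT yv]] : max_linear v = 0 \/
    exists2 y, y \in T & max_linear v = inner (h y) v.
- rewrite /max_linear; elim/big_ind: _ => [|x1 x2 H1 H2|y yT].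
  + by left.
  + by rewrite maxEle; case: ifP.
  + by right; exists y.
- exists 0; split=> [i||u]; rewrite ?inner0 ?mxE //; first by lra.
  exact: bigmax_ge_id.
- exists (h y); split=> // u.
  exact: (le_bigmax_cond _ (fun y => inner (h y) u)).
Qed.

Lemma max_linear_subgradient v : exists d,
  cube R L d /\ subgradient max_linear v d.
Proof.
have [d [dc dv du]] := max_linear_support v; exists d; split=> // u _.
by rewrite innerBr dv addrC subrK.
Qed.

Lemma max_linear_convex (D : set 'rV[R]_L) : convex_function D max_linear.
Proof.
move=> t x y _ _.
have [d [_ dv du]] := max_linear_support (t%:num *: x + (1 - t%:num) *: y).
rewrite [leLHS]/(max_linear _) /=.
rewrite -[leLHS]dv innerDr !innerZr convRE lerD //.
  by rewrite ler_wpM2l.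
by rewrite ler_wpM2l // subr_ge0.
Qed.

End MaxLinear.

(** * Recovering the hidden bit from the penalty and the mass on the support *)

Section Penalty.
Variables (R : realType) (n : nat) (T : {set n.-tuple bool}).
Variables (a : n.-tuple bool -> bool) (side : 'I_n -> bool).

Definition penalty (x : n.-tuple bool) : 'rV[R]_n :=
  \row_p (if tnth x p then (side p != a x)%:R else -1).

Definition point (x : n.-tuple bool) : 'rV[R]_n := \row_p (tnth x p)%:R.

Definition side_mass (v : 'rV[R]_n) (x : n.-tuple bool) (b : bool) : R :=
  \sum_(p | tnth x p && (side p == b)) v 0 p.

Definition guess (v : 'rV[R]_n) (x : n.-tuple bool) : bool :=
  side_mass v x false < side_mass v x true.

Lemma penalty_cube x : cube R n (penalty x).
Proof. by move=> p; rewrite mxE; case: ifP => _; [case: (_ != _)|]; apply/andP; split=> /=; lra. Qed.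

Lemma inner_point (v : 'rV[R]_n) x b :
  inner v (point x) = side_mass v x b + side_mass v x (~~ b).
Proof.
rewrite /inner (bigID (tnth x)) /= [X in _ + X]big1 ?addr0; last first.
  by move=> p /negPf px; rewrite mxE px mulr0.
rewrite (bigID (fun p => side p == b)) /=; congr (_ + _); apply: eq_big => p.
- by [].
- by case/andP=> px _; rewrite mxE px mulr1.
- by case: (side p) b => -[].
- by case/andP=> px _; rewrite mxE px mulr1.
Qed.

(** As [v] has total mass 1, its mass off the support of [x] is [1 - inner v (point x)]. *)
Lemma inner_penalty (v : 'rV[R]_n) x : simplex R n v ->
  inner (penalty x) v = side_mass v x (~~ a x) - (1 - inner v (point x)).
Proof.
move=> [_ v1]; rewrite (inner_point _ _ (a x)) -v1 [in RHS](bigID (tnth x)) /=.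
rewrite [X in _ - (X + _ - _)](bigID (fun p => side p == a x)) /=.
rewrite -/(side_mass v x (a x)).
have -> : \sum_(i | tnth x i && (side i != a x)) v 0 i = side_mass v x (~~ a x).
  by apply: eq_bigl => p; case: (side p) (a x) => -[].
rewrite [X in _ = _ - X]addrAC subrr add0r.
rewrite /inner (bigID (tnth x)) /= -sumrN; congr (_ + _).
  rewrite (bigID (fun p => side p == a x)) /= big1 ?add0r; last first.
    by move=> p /andP[px /eqP pa]; rewrite mxE px pa eqxx mul0r.
  apply: eq_big => [p|p /andP[px pa]]; last by rewrite mxE px pa mul1r.
  by case: (side p) (a x) => -[].
by apply: eq_bigr => p /negPf px; rewrite mxE px mulN1r.
Qed.

(** Let [q] be the mass of [v] off the support. After a wrong guess the wrong side carries at least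
    [(1 - q) / 2], so the penalty is at least [(1 - 3 * q) / 2]; this yields the coefficients 2 and
    3. *)
Lemma guess_error (v : 'rV[R]_n) x : simplex R n v -> x \in T ->
  (a x != guess v x)%:R <=
  2 * max_linear T penalty v + 3 * (1 - inner v (point x)).
Proof.
move=> sv xT.
have phi0 : 0 <= max_linear T penalty v by exact: bigmax_ge_id.
have phix : inner (penalty x) v <= max_linear T penalty v.
  exact: (le_bigmax_cond _ (fun y => inner (penalty y) v)).
have [v0 v1] := sv.
have out0 : inner v (point x) <= 1.
  rewrite -v1; apply: ler_sum => p _; rewrite mxE.
  by case: (tnth x p); rewrite ?mulr1 // mulr0.
case: eqP => [_|/eqP ne] /=; first by lra.
have le_side : side_mass v x (a x) <= side_mass v x (~~ a x).
  move: ne; rewrite /guess; case: (a x) => /=; case: ltP => //= *; exact: ltW.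
move: phix; rewrite inner_penalty // (inner_point v x (a x)) in out0 *.
by move=> phix; lra.
Qed.

Definition unif (x : n.-tuple bool) : R := (x \in T)%:R / #|T|%:R.

Lemma expect_unif (F : n.-tuple bool -> R) :
  expect unif F = #|T|%:R^-1 * \sum_(x in T) F x.
Proof.
rewrite /expect mulr_sumr [RHS]big_mkcond; apply: eq_bigr => x _.
by rewrite /unif; case: (x \in T); rewrite ?mul1r // !mul0r.
Qed.

Lemma unif_pmf : (0 < #|T|)%N -> is_pmf unif.
Proof.
move=> T0; split=> [x|]; first by rewrite divr_ge0.
have := expect_unif (fun=> 1); rewrite sumr_const mulVf ?pnatr_eq0 ?gtn_eqF //.
by move=> <-; apply: eq_bigr => x _; rewrite mulr1.
Qed.

(** Averaging [guess_error] bounds the error rate by [2 * 0.05 + 3 * 0.05], exactly a quarter. *)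
Lemma few_errors (s gstar : n.-tuple bool -> 'rV[R]_n) : (0 < #|T|)%N ->
  (forall x, simplex R n (s x)) ->
  {in T, forall x, max_linear T penalty (gstar x) = 0} ->
  {in T, forall x, inner (gstar x) (point x) = 1} ->
  `| expect unif (fun x => inner (s x - gstar x) (point x)) | <= 5 / 100 ->
  entropy unif (max_linear T penalty) s >=
    entropy unif (max_linear T penalty) gstar - 5 / 100 ->
  (4 * #|[set x in T | a x != guess (s x) x]%SET| <= #|T|)%N.
Proof.
move=> T0 s1 g0 g1; rewrite /entropy !expect_unif.
have N0 : 0 < #|T|%:R :> R by rewrite ltr0n.
rewrite (eq_bigr (fun x => inner (s x) (point x) - 1)); last first.
  by move=> x xT; rewrite innerC innerBr !(innerC (point x)) g1.
rewrite [X in - (_ * X) - _]big1 // => out phi.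
have err : #|[set x in T | a x != guess (s x) x]%SET|%:R <=
    \sum_(x in T) (2 * max_linear T penalty (s x)
                   + 3 * (1 - inner (s x) (point x))) :> R.
  rewrite -sum1_card natr_sum big_mkcond [leRHS]big_mkcond /=.
  apply: ler_sum => x _; rewrite inE; case: ifP => [/andP[xT e]|].
    by rewrite xT; have := guess_error (s1 x) xT; rewrite e.
  case: ifP => // xT _; apply: le_trans (guess_error (s1 x) xT).
  exact: ler0n.
rewrite -(ler_nat R) natrM.
move: err; rewrite big_split /= -!mulr_sumr => err.
set P := \sum_(x in T) max_linear _ _ _ in phi err.
have EO : \sum_(x in T) (1 - inner (s x) (point x)) =
    - \sum_(x in T) (inner (s x) (point x) - 1).
  by rewrite -sumrN; apply: eq_bigr => x _; rewrite opprB.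
rewrite EO in err; set Q := \sum_(x in T) (_ - 1) in out err.
have : `|Q| <= 5 / 100 * #|T|%:R.
  by move: out; rewrite normrM gtr0_norm ?invr_gt0 // ler_pdivrMl // mulrC.
rewrite ler_norml => /andP[Q1 _].
have : P <= 5 / 100 * #|T|%:R.
  move: phi; rewrite mulr0 oppr0 sub0r lerN2 ler_pdivrMl // mulrC.
  by [].
by move=> P1; lra.
Qed.

End Penalty.

(** * Codewords as bit strings, and the distributions [gstar] *)

Section Embedding.
Variables (n m : nat) (pos : 'I_m * 'I_16 * bool -> 'I_n).
Hypothesis pos_inj : injective pos.
Local Notation word := {ffun 'I_m -> 'I_16}.

Definition enc (c : word) : n.-tuple bool :=
  [tuple [exists i, exists b, p == pos (i, c i, b)] | p < n].

(** Codewords mark each letter on both sides, so one side is enough to decode. The default letter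
    makes [gstar] a distribution at every [x], codeword or not. *)
Definition dec (x : n.-tuple bool) : word :=
  [ffun i => odflt ord0 [pick j | tnth x (pos (i, j, true))]].

Definition pos_side (p : 'I_n) : bool :=
  [exists i, exists j, p == pos (i, j, true)].

Lemma tnth_enc c i j b : tnth (enc c) (pos (i, j, b)) = (c i == j).
Proof.
rewrite tnth_mktuple; apply/existsP/eqP => [[i' /existsP[b' /eqP/pos_inj[-> -> _]]]|<-] //.
by exists i; apply/existsP; exists b.
Qed.

Lemma encK : cancel enc dec.
Proof.
move=> c; apply/ffunP => i; rewrite ffunE.
case: pickP => [j|/(_ (c i))]; rewrite tnth_enc ?eqxx // => /eqP->.
by [].
Qed.

Lemma pos_sideE i j b : pos_side (pos (i, j, b)) = b.
Proof.
apply/existsP/idP => [[i' /existsP[j' /eqP/pos_inj[_ _ ->]]]|bT] //.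
by exists i; apply/existsP; exists j; rewrite bT.
Qed.

Variables (R : realType) (a : n.-tuple bool -> bool).

Definition gstar (x : n.-tuple bool) : 'rV[R]_n :=
  \row_p (m%:R^-1 * \sum_i (p == pos (i, dec x i, a x))%:R).

Lemma inner_gstar (u : 'rV[R]_n) x :
  inner u (gstar x) = m%:R^-1 * \sum_i u 0 (pos (i, dec x i, a x)).
Proof.
rewrite /inner; under eq_bigr do rewrite mxE mulrCA mulr_sumr.
rewrite -mulr_sumr exchange_big /=; congr (_ * _); apply: eq_bigr => i _.
rewrite (bigD1 (pos (i, dec x i, a x))) //= eqxx mulr1 big1 ?addr0 // => p.
by move=> /negPf ->; rewrite mulr0.
Qed.

Hypothesis m0 : (0 < m)%N.

Lemma gstar_simplex x : simplex R n (gstar x).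
Proof.
split=> [p|]; first by rewrite mxE mulr_ge0 ?invr_ge0 // sumr_ge0.
transitivity (inner (const_mx 1) (gstar x)).
  by apply: eq_bigr => p _; rewrite [in RHS]mxE mul1r.
rewrite inner_gstar; under eq_bigr do rewrite mxE.
by rewrite sumr_const card_ord mulVf // pnatr_eq0 gtn_eqF.
Qed.

Lemma gstar_point c : inner (gstar (enc c)) (point R (enc c)) = 1.
Proof.
rewrite innerC inner_gstar.
under eq_bigr do rewrite mxE tnth_enc encK eqxx.
by rewrite sumr_const card_ord mulVf // pnatr_eq0 gtn_eqF.
Qed.

(** The form of [d] charges [gstar (enc c)] at most 1 where [d] and [c] agree and -1 where they
    differ; for [d != c] agreements are no more than half, and for [d = c] every charge is 0. *)
Lemma max_linear_gstar (C : {set word}) :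
  {in C &, forall u v : word, u != v -> 2 * #|[set i | u i == v i]%SET| <= m}%N ->
  {in (enc @: C)%SET, forall x,
    max_linear (enc @: C)%SET (penalty R a pos_side) (gstar x) = 0}.
Proof.
move=> Cdist _ /imsetP[c cC ->]; apply/eqP; rewrite eq_le bigmax_ge_id andbT.
apply/bigmax_leP; split=> // _ /imsetP[d dC ->].
rewrite inner_gstar mulr_ge0_le0 ?invr_ge0 ?ler0n // encK.
under eq_bigr do rewrite mxE tnth_enc pos_sideE.
have [->|dc] := eqVneq d c.
  by rewrite big1 // => i _; rewrite eqxx eqxx.
have := Cdist _ _ dC cC dc.
rewrite (bigID (fun i => d i == c i)) /=.
set A := [set i | d i == c i]%SET => HA.
apply: (@le_trans _ _ (\sum_(i in A) 1 + \sum_(i in ~: A) -1)).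
  apply: lerD.
    rewrite [leRHS](eq_bigl (fun i => d i == c i)); last by move=> i; rewrite inE.
    by apply: ler_sum => i ->; rewrite lern1 leq_b1.
  rewrite [leRHS](eq_bigl (fun i => d i != c i)); last by move=> i; rewrite !inE.
  by apply: ler_sum => i /negPf ->.
have := cardsC A; rewrite card_ord !sumr_const mulNrn subr_le0 ler_nat => E.
have arith (p q r : nat) : (2 * p <= r)%N -> (p + q = r)%N -> (p <= q)%N by lia.
exact: arith HA E.
Qed.

End Embedding.

(** * Numerical bounds and assembly of the lower bound *)

Lemma ccode_few (n k m N : nat) : (13 <= k)%N -> k = (n %/ 128)%N -> m = (n %/ 32)%N ->
  (2 ^ m <= N)%N ->
  (#|{: ccode n (2 ^ k) n}| ^ 2 * 25 ^ N < 32 ^ N)%N.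
Proof.
move=> k13 kE mE mN.
have [K KE] : {K | K = 2 ^ k}%N by exists (2 ^ k)%N.
have kK : (k < K)%N by rewrite KE; exact: ltn_expl.
have K13 : (2 ^ 13 <= K)%N by rewrite KE leq_exp2l.
have K0 : (0 < K)%N by exact: leq_trans K13.
have n0 : (0 < n)%N by lia.
rewrite -KE.
have nK : (n <= 128 * K)%N by lia.
set W := (n + K).+1.
have W0 : (0 < W)%N by [].
have WK : (W <= 2 ^ (2 * k))%N.
  rewrite mulnC expnM -KE /W -mulnn.
  have : (130 * K <= K * K)%N by rewrite leq_mul2r (leq_trans _ K13) ?orbT.
  by move: kK; lia.
(* A wire number takes [2 * k] bits. Each of the [K] gates costs three of them, each of the [n]
   outputs [1 + 2 * K]. *)
set E := (6 * k * K + 2 * k * (1 + 2 * K) * n)%N.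
have ME : (#|{: ccode n K n}| <= 2 ^ E)%N.
  rewrite card_ccode -/W /E expnD leq_mul //.
    rewrite expnM leq_exp2r //.
    rewrite (@leq_trans (W ^ 3)) //.
      have : (4 <= W)%N by rewrite /W; lia.
      rewrite !expnS expn0 muln1; nia.
    by rewrite (_ : 6 * k = 2 * k * 3)%N 1?(expnM 2 (2 * k)) ?leq_exp2r //; lia.
  rewrite expnM leq_exp2r // -mulnA -expnD -expnS addnn -mul2n (expnM 2 (2 * k)).
  by rewrite leq_exp2r.
have EN : (6 * E < N)%N.
  apply: leq_trans mN.
  rewrite (@leq_trans (2 ^ (k * 4))) ?leq_exp2l //; last by lia.
  rewrite expnM -KE /E.
  have E1 : (6 * k * K <= 6 * K * K * K)%N by nia.
  have E2 : (2 * k * (1 + 2 * K) * n <= 2 * K * (3 * K) * (128 * K))%N.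
    by rewrite !leq_mul //; lia.
  have -> : (K ^ 4 = K * (K * K * K))%N by rewrite !expnS expn0; lia.
  (* Here [4644 = 6 * (6 + 2 * 3 * 128)], which is below [2 ^ 13 <= K]. *)
  apply: (@leq_ltn_trans (4644 * (K * K * K))); first by lia.
  rewrite ltn_pmul2r; last by rewrite !muln_gt0; lia.
  by apply: leq_trans K13.
(* Cubing leaves [2 ^ (6 * E) <= 2 ^ N] and [2 * 25 ^ 3 < 32 ^ 3]. *)
rewrite -(@ltn_exp2r _ _ 3) // expnMn -!expnM.
rewrite (@leq_ltn_trans (2 ^ N * 25 ^ (N * 3))) //; last first.
  rewrite !(mulnC N) !expnM -expnMn ltn_exp2r //; last by lia.
rewrite leq_mul // (leq_trans (n := (2 ^ E) ^ 6)%N) ?leq_exp2r //.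
by rewrite -expnM leq_exp2l // ltnW // mulnC.
Qed.

(** The only gate, wire [n], is constantly true and serves as denominator 1 of all outputs; each
    output has size 3. *)
Lemma identity_circuit (R : realType) (n : nat) : exists C : circuit n,
  computes C (@point R n) /\ circuit_size C = (3 * n).+1%N.
Proof.
(* Wire [n.+1] does not exist and reads [false]: the sign is [+]. *)
pose o (i : 'I_n) := RatOut n.+1 [:: (i : nat)] [:: n].
exists (Circuit [:: Gconst true] (mktuple o)); split=> [x|].
  apply/rowP => i; rewrite !mxE tnth_mktuple /rat_out_val /= !nth_rcons !size_tuple.
  rewrite ltn_ord ltnn eqxx ltnNge leqnSn /= gtn_eqF // expr0 mul1r.
  by rewrite -tnth_nth invr1 mulr1; case: (tnth x i).
rewrite /circuit_size /=; under eq_bigr do rewrite tnth_mktuple. rewrite /rat_out_size /=.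
by rewrite sum_nat_const card_ord mulnC add1n.
Qed.

Lemma circuit_complexity_ge (R : realType) (n L S : nat)
    (F : n.-tuple bool -> 'rV[R]_L) :
  (forall C : circuit L, computes C F -> (S <= circuit_size C)%N) ->
  (S%:R%:E <= circuit_complexity F)%E.
Proof.
move=> lb; apply: le_ereal_inf_tmp => _ [C CF <-].
by rewrite lee_fin ler_nat lb.
Qed.

(** Doubling 128 to 256 absorbs the rounding in [n %/ 128]. *)
Lemma expR_ln2_le (R : realType) (n : nat) : (128 <= n)%N ->
  expR (ln 2 / 256 * n%:R) <= (2 ^ (n %/ 128))%N%:R :> R.
Proof.
move=> n128.
have l0 : 0 < ln 2 :> R by rewrite ln_gt0 // ltr1n.
rewrite natrX -{2}[2%:R]lnK ?posrE // -expRM_natl ler_expR.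
have : n%:R <= 256 * (n %/ 128)%:R :> R by rewrite -natrM ler_nat; lia.
move=> nk; rewrite -mulrA [leRHS]mulrC ler_pM2l //; lra.
Qed.

Theorem theorem1p12 (R : realType) :
  exists (c K : R) (n0 : nat), 0 < c /\ 0 < K /\
  forall n : nat, (0 < n)%N -> (n0 <= n)%N ->
  let L := n in
  exists (mu : n.-tuple bool -> R)
         (gstar : n.-tuple bool -> 'rV[R]_L)
         (f : n.-tuple bool -> 'rV[R]_L)
         (phi : 'rV[R]_L -> R)
         (grad : 'rV[R]_L -> 'rV[R]_L),
    is_pmf mu /\
    (forall x, simplex R L (gstar x)) /\
    (forall x, cube R L (f x)) /\
    (exists C : circuit L,
        computes C f /\ (circuit_size C)%:R <= K * n%:R) /\
    (forall x i, f x 0 i = (tnth x i)%:R) /\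
    convex_function (simplex R L) phi /\
    (forall v, simplex R L v ->
        cube R L (grad v) /\ subgradient phi v (grad v)) /\
    forall s : n.-tuple bool -> 'rV[R]_L,
      (forall x, simplex R L (s x)) ->
      `| expect mu (fun x => inner (s x - gstar x) (f x)) | <= 5 / 100 ->
      entropy mu phi s >= entropy mu phi gstar - 5 / 100 ->
      ((expR (c * L%:R))%:E <= circuit_complexity s)%E.
Proof.
(* The 4 covers [3 * n + 1 <= 4 * n], and [128 * 13] ensures [k >= 13]. *)
exists (ln 2 / 256), 4, (128 * 13)%N.
split; first by rewrite divr_gt0 // ln_gt0 // ltr1n.
split; first by [].
move=> n n0 nlarge L.
(* Each of the [m] letters takes [16 * 2 = 32] coordinates. *)
pose m := (n %/ 32)%N; pose k := (n %/ 128)%N.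
have k13 : (13 <= k)%N by rewrite /k; lia.
have m0 : (0 < m)%N by rewrite /m; lia.
have card_pos : (#|{: 'I_m * 'I_16 * bool}| <= n)%N.
  by rewrite !card_prod !card_ord card_bool /m; lia.
pose pos t : 'I_n := widen_ord card_pos (enum_rank t).
have pos_inj : injective pos.
  by move=> t t' /(congr1 val) /= /val_inj; exact: enum_rank_inj.
have [C [Cdist Cbig]] := code_exists m0.
pose T := (enc pos @: C)%SET.
have cardT : #|T| = #|C| by exact: card_imset (can_inj (encK pos_inj)).
have T0 : (0 < #|T|)%N by rewrite cardT; apply: leq_trans Cbig; rewrite expn_gt0.
have small := ccode_few k13 (erefl k) (erefl m) Cbig.
rewrite -cardT in small.
(* Every circuit code becomes a predictor through [guess], which does not depend on [a]; so one [a]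
   can be hard for all of them. *)
have [a ahard] := hard_on_average
  (fun z x => guess (pos_side pos) (circuit_eval R (cdecode z) x) x) small.
pose h := penalty R a (pos_side pos).
have hcube x : cube R n (h x) by exact: penalty_cube.
have [grad gradP] := boolp.choice (max_linear_subgradient T hcube).
exists (unif R T), (gstar pos R a), (@point R n), (max_linear T h), grad.
split; first exact: unif_pmf.
split; first exact: gstar_simplex.
split; first by move=> x p; rewrite mxE; case: (tnth x p); apply/andP; split=> /=; lra.
split.
  have [D [Dcomp Dsize]] := identity_circuit R n.
  by exists D; split=> //; rewrite Dsize -natrM ler_nat; lia.
split; first by move=> x p; rewrite mxE.
split; first exact: max_linear_convex.
split; first by move=> v _; exact: gradP.
move=> s s1 sout sent.
apply: (@le_trans _ _ (2 ^ k)%N%:R%:E).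
  by rewrite lee_fin; apply: expR_ln2_le; lia.
(* A circuit for [s] of size below [2 ^ k] would have a code, and its predictor would err on at most
   a quarter of [T]. *)
apply: circuit_complexity_ge => D Ds; rewrite leqNgt; apply/negP => /ltnW Dsmall.
have [z zE] := ccode_exists n R Dsmall.
have phi0 : {in T, forall x, max_linear T h (gstar pos R a x) = 0}.
  exact: max_linear_gstar.
have point1 : {in T, forall x, inner (gstar pos R a x) (point R x) = 1}.
  by move=> _ /imsetP[c _ ->]; exact: gstar_point.
have := few_errors T0 s1 phi0 point1 sout sent; rewrite leqNgt => /negP; apply.
apply: leq_trans (ahard z) _; rewrite leq_mul2l /=; apply/subset_leq_card/fintype.subsetP => x.
by rewrite !inE zE Ds.
Qed.
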